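(* Let $(A,B,\boldsymbol{c})$ be a positive $d$-dimensional instance of the Continuous Polytope Escape Problem with $A\in\mathbb{Q}^{d\times d}$, $B\in\mathbb{Q}^{n\times d}$, $\boldsymbol{c}\in\mathbb{Q}^n$, whose polytope $\mathcal{P}_{B,\boldsymbol{c}}=\{\boldsymbol{x}\in\mathbb{R}^d \mid B\boldsymbol{x}\le \boldsymbol{c}\}$ is compact, and suppose the tuple $(A,B,\boldsymbol{c})$ has bit size $b$. Then the time to escape the polytope is bounded by $$T = 4\exp\left(640\, b\, d^{4d+10}\right)= e^{b d^{O(d)}};$$ that is, for every $\boldsymbol{x}_0\in\mathcal{P}_{B,\boldsymbol{c}}$ there exists $t_0\in[0,T]$ such that $\exp(At_0)\boldsymbol{x}_0\notin\mathcal{P}_{B,\boldsymbol{c}}$.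
   Context: A $d$-dimensional instance of the Continuous Polytope Escape Problem (CPEP) is a triple $(A,B,\boldsymbol{c})$ with $A$ a $d\times d$ matrix, $B$ an $n\times d$ matrix and $\boldsymbol{c}$ a vector of length $n$; it represents the differential equation $\dot{\boldsymbol{x}}(t)=A\boldsymbol{x}(t)$, $\boldsymbol{x}(0)=\boldsymbol{x}_0$, with solution $\boldsymbol{x}(t)=\exp(At)\boldsymbol{x}_0$, together with the polytope $\mathcal{P}_{B,\boldsymbol{c}}=\{\boldsymbol{x}\in\mathbb{R}^d\mid B\boldsymbol{x}\le\boldsymbol{c}\}$ (componentwise inequality). The instance is positive if every trajectory escapes: for every $\boldsymbol{x}_0\in\mathcal{P}_{B,\boldsymbol{c}}$ there is $t\ge 0$ with $\exp(At)\boldsymbol{x}_0\notin\mathcal{P}_{B,\boldsymbol{c}}$ (re-entering later is allowed). Rationals are encoded in binary as pairs of integers (numerator, denominator), and the bit size of the tuple is the total number of bits of its encoding. The notation $e^{bd^{O(d)}}$ means bounded by $\exp(\kappa b d^{\kappa d})$ for an absolute constant $\kappa>0$. *)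

(* Defs.v *)
From HB Require Import structures.
From mathcomp Require Import all_boot all_order all_algebra.
From mathcomp Require Import all_classical all_reals all_analysis.

Set Implicit Arguments.
Unset Strict Implicit.
Unset Printing Implicit Defensive.

Import Order.TTheory GRing.Theory Num.Theory.
Import numFieldNormedType.Exports.

Local Open Scope classical_set_scope.
Local Open Scope ring_scope.

(* Number of binary digits; zero is written with the single digit 0. *)
Definition nat_bitsize (k : nat) : nat := (trunc_log 2 k).+1.

(* The pair (numerator, denominator) in lowest terms with positive
   denominator; the leading summand 1 is the sign bit of the numerator. *)
Definition rat_bitsize (q : rat) : nat :=
  (1 + nat_bitsize `|numq q|%N + nat_bitsize `|denq q|%N)%N.

Definition mx_bitsize (m n : nat) (M : 'M[rat]_(m, n)) : nat :=
  (\sum_(i < m) \sum_(j < n) rat_bitsize (M i j))%N.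

Definition cpep_bitsize (d n : nat)
    (A : 'M[rat]_d) (B : 'M[rat]_(n, d)) (c : 'cV[rat]_n) : nat :=
  (mx_bitsize A + mx_bitsize B + mx_bitsize c)%N.

(* Matrix exponential; the limit is taken in the max-norm topology of 'M[R]_d. *)
Definition mexp (R : realType) (d : nat) (M : 'M[R]_d) : 'M[R]_d :=
  limn (series (fun k : nat => (k`!%:R : R)^-1 *: M ^+ k)).

Definition polytope (R : realType) (d n : nat)
    (B : 'M[R]_(n, d)) (c : 'cV[R]_n) : set 'cV[R]_d :=
  [set x | forall i : 'I_n, (B *m x) i 0 <= c i 0].

Definition trajectory (R : realType) (d : nat)
    (A : 'M[R]_d) (x0 : 'cV[R]_d) (t : R) : 'cV[R]_d :=
  mexp (t *: A) *m x0.

Definition cpep_positive (R : realType) (d n : nat)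
    (A : 'M[R]_d) (B : 'M[R]_(n, d)) (c : 'cV[R]_n) : Prop :=
  forall x0 : 'cV[R]_d, polytope B c x0 ->
    exists t : R, 0 <= t /\ ~ polytope B c (trajectory A x0 t).

Definition ratmx (R : realType) (m n : nat) (M : 'M[rat]_(m, n)) : 'M[R]_(m, n) :=
  map_mx (@ratr R) M.
Arguments ratmx R {m n} M.

(* Main.v *)
(* Positivity forces the polytope P to contain no equilibrium of A, since an
   equilibrium in P never escapes. When P /\ ker A is empty, Farkas' lemma
   gives lambda >= 0 and mu with lambda B + mu A = 0 and lambda c = -1, so that
   mu A x >= 1 on P: the linear function mu x grows at unit rate along the
   trajectory as long as it stays in P, and the escape time is at most twice the
   maximum of |mu x| on P. After clearing denominators, Caratheodory and Cramer
   bound both mu and (through the cone generated by the rows of B) the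
   coordinates of the points of P. The bound obtained this way is only
   exponential in b d^2, far below the announced one. *)

Require Import Defs.
From HB Require Import structures.
From mathcomp Require Import all_boot all_order all_algebra all_fingroup.
From mathcomp Require Import all_classical all_reals all_analysis.
From mathcomp Require Import lra zify.

Set Implicit Arguments.
Unset Strict Implicit.
Unset Printing Implicit Defensive.

Import Order.TTheory GRing.Theory Num.Theory.
Import numFieldNormedType.Exports.

Local Open Scope classical_set_scope.
Local Open Scope ring_scope.

(** * Farkas multipliers and bounds on their size *)

(** Algebraic induction on the rows of [M]. If the rows [N] below the first row [a] already imply
    the inequality for [w], then [a] gets weight 0; otherwise some [y1] with [N *m y1 <= 0] and
    positive [w *m y1] must have positive [a *m y1]. *)
Lemma farkas (F : realFieldType) (m k : nat) (M : 'M[F]_(m, k)) (w : 'rV[F]_k) :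
  (forall y : 'cV_k, (forall i, (M *m y) i 0 <= 0) -> (w *m y) 0 0 <= 0) ->
  exists2 z : 'rV_m, (forall i, 0 <= z 0 i) & z *m M = w.
Proof.
elim: m M w => [|m IH] M w Hw.
  exists 0 => [i|]; first by rewrite mxE.
  have M0 (y : 'cV_k) i : (M *m y) i 0 <= 0 by case: i.
  rewrite mul0mx; apply/rowP => j.
  have := Hw (delta_mx j 0) (M0 _); have := Hw (- delta_mx j 0) (M0 _).
  by rewrite mulmxN -colE !mxE; lra.
pose a : 'rV_k := usubmx (M : 'M[F]_(1 + m, k)).
pose N : 'M[F]_(m, k) := dsubmx (M : 'M[F]_(1 + m, k)).
have defM : M = col_mx a N by rewrite /a /N vsubmxK.
have rowM t z : (row_mx t z : 'rV_(1 + m)) *m M = t *m a + z *m N.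
  by rewrite -mul_row_col -defM.
have HM (y : 'cV_k) : (a *m y) 0 0 <= 0 -> (forall i, (N *m y) i 0 <= 0) ->
    (w *m y) 0 0 <= 0.
  move=> ay Ny; apply: Hw => i.
  have ->: M *m y = col_mx (a *m y) (N *m y) by rewrite -mul_col_mx -defM.
  by rewrite mxE; case: fintype.split => j //; rewrite (ord1 j).
have [/IH[z z0 zN]|] := pselect (forall y : 'cV_k,
    (forall i, (N *m y) i 0 <= 0) -> (w *m y) 0 0 <= 0).
  exists (row_mx (0 : 'rV_1) z : 'rV_(1 + m)) => [i|].
    by rewrite mxE; case: fintype.split => j; rewrite ?mxE.
  by rewrite rowM mul0mx add0r.
move/existsNP => [y1 /not_implyP[Ny1 /negP]]; rewrite -ltNge => wy1.
have ay1 : 0 < (a *m y1) 0 0.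
  by rewrite ltNge; apply/negP => ay; move: (HM _ ay Ny1); lra.
(* Induct on N and w projected along y0 onto the kernel of a. *)
pose y0 := ((a *m y1) 0 0)^-1 *: y1.
have ay0 : a *m y0 = 1%:M.
  apply/matrixP => i j; rewrite !ord1 -scalemxAr mxE mulVf ?lt0r_neq0 //.
  by rewrite mxE.
have Ny0 i : (N *m y0) i 0 <= 0.
  by rewrite -scalemxAr mxE mulr_ge0_le0 // invr_ge0 ltW.
have wy0 : 0 <= (w *m y0) 0 0.
  by rewrite -scalemxAr mxE mulr_ge0 ?invr_ge0 // ltW.
have projE p (P : 'M[F]_(p, k)) y :
    (P - P *m y0 *m a) *m y = P *m (y - y0 *m a *m y).
  by rewrite mulmxBl mulmxBr !mulmxA.
have [] := IH (N - N *m y0 *m a) (w - w *m y0 *m a).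
  move=> y Hy; rewrite projE; apply: HM => [|i]; last by rewrite -projE.
  by rewrite -projE ay0 mul1mx subrr mul0mx mxE.
move=> z z0 zN.
(* Undoing the projection leaves this coefficient on [a]; it is nonnegative because [w *m y0 >= 0],
   [z >= 0] and [N *m y0 <= 0]. *)
pose t := w *m y0 - z *m N *m y0.
exists (row_mx t z : 'rV_(1 + m)) => [i|].
  rewrite mxE; case: fintype.split => j; rewrite ?(ord1 j) //.
  rewrite /t mxE [X in _ <= _ + X]mxE -mulmxA.
  suff : (z *m (N *m y0)) 0 0 <= 0 by move: wy0; lra.
  by rewrite mxE sumr_le0 // => l _; rewrite mulr_ge0_le0.
rewrite rowM /t mulmxBl.
move: zN; rewrite mulmxBr !mulmxA => zN.
by rewrite addrAC -addrA zN addrC subrK.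
Qed.



(** While the rows are dependent, moving the weights along a dependency until one of them vanishes
    removes a row and keeps the combination. *)
Lemma caratheodory (F : realFieldType) (m k : nat) (M : 'M[F]_(m, k)) (z : 'rV_m) :
  (forall i, 0 <= z 0 i) ->
  exists r (f : 'I_r -> 'I_m) (v : 'rV_r),
    [/\ row_free (rowsub f M), forall i, 0 <= v 0 i
      & v *m rowsub f M = z *m M].
Proof.
elim: m M z => [|m IH] M z z0.
  exists 0%N, id, z; split=> //.
    by rewrite /row_free eqn_leq rank_leq_row.
  by congr mulmx; apply/matrixP => i j; rewrite mxE.
have [freeM|] := boolP (row_free M).
  have idM : rowsub id M = M by apply/matrixP => i j; rewrite mxE.
  by exists m.+1, id, z; rewrite idM.
rewrite -kermx_eq0 => /rowV0Pn[u0 /sub_kermxP u0M u0N0].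
(* Up to sign a dependency has a positive entry, so the minimal ratio below ranges over a nonempty
   set. *)
have [u [uM [i1 ui1]]] : exists u : 'rV_m.+1, u *m M = 0 /\ exists i, 0 < u 0 i.
  have /rV0Pn[i ui] := u0N0.
  have [ui_gt0|ui_le0] := ltP 0 (u0 0 i).
    by exists u0; split=> //; exists i.
  exists (- u0); rewrite mulNmx u0M oppr0; split=> //; exists i.
  by rewrite mxE oppr_gt0 lt_neqAle ui.
have [i0 ui0 min_i0] :=
  @arg_minP _ _ _ i1 (fun i => 0 < u 0 i) (fun i => z 0 i / u 0 i) ui1.
(* Subtracting the largest multiple of u keeping z nonnegative kills z_i0. *)
pose z' := z - (z 0 i0 / u 0 i0) *: u.
have z'M : z' *m M = z *m M by rewrite mulmxBl -scalemxAl uM scaler0 subr0.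
have z'0 i : 0 <= z' 0 i.
  rewrite !mxE subr_ge0; have [ui|ui] := ltP 0 (u 0 i).
    by rewrite -ler_pdivlMr // min_i0.
  rewrite (le_trans _ (z0 i)) // mulr_ge0_le0 // divr_ge0 //; exact: ltW.
have z'i0 : z' 0 i0 = 0 by rewrite !mxE divfK ?subrr // gt_eqF.
have [|r [f [v [free v0 vM]]]] :=
  IH (rowsub (lift i0) M) (colsub (lift i0) z').
  by move=> i; rewrite mxE.
have compM : rowsub (lift i0 \o f) M = rowsub f (rowsub (lift i0) M).
  by apply/matrixP => i j; rewrite !mxE.
exists r, (lift i0 \o f), v; rewrite compM; split=> //.
rewrite vM -z'M; apply/rowP => j; rewrite !mxE (bigD1_ord i0) //= z'i0 mul0r add0r.
by apply: eq_bigr => i _; rewrite !mxE.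
Qed.

Lemma det_norm_le (F : realFieldType) (r : nat) (Q : 'M[F]_r) (H : F) :
  (forall i j, `|Q i j| <= H) -> `|\det Q| <= r`!%:R * H ^+ r.
Proof.
move=> QH; apply: le_trans (ler_norm_sum _ _ _) _.
rewrite mulr_natl -card_Sn -sumr_const.
apply: ler_sum => s _; rewrite normrM normrX normrN1 expr1n mul1r normr_prod.
rewrite -[X in _ ^+ X](card_ord r) -prodr_const.
by apply: ler_prod => i _; rewrite normr_ge0 QH.
Qed.

(** Cramer's rule: [v] is [v *m Q *m \adj Q] divided by a determinant which is a nonzero integer, so
    the division cannot increase moduli. *)
Lemma unit_row_norm_le (F : archiRealFieldType) (r : nat) (Q : 'M[F]_r)
    (v : 'rV_r) (H : F) : 1 <= H ->
  Q \in unitmx -> (forall i j, Q i j \is a Num.int) ->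
  (forall i j, `|Q i j| <= H) -> (forall j, `|(v *m Q) 0 j| <= H) ->
  forall i, `|v 0 i| <= r%:R * r`!%:R * H ^+ r.+1.
Proof.
move=> H1 Qunit Qint QH vQH i.
have H0 : 0 <= H by apply: le_trans H1.
have det_ge1 : 1 <= `|\det Q|.
  apply: norm_intr_ge1; last by rewrite -unitfE -unitmxE.
  by apply: rpred_sum => s _; rewrite rpredMsign rpred_prod.
have -> : v 0 i = (\det Q)^-1 * (v *m Q *m \adj Q) 0 i.
  rewrite -mulmxA mul_mx_adj mul_mx_scalar mxE mulKf // -normr_gt0.
  exact: lt_le_trans det_ge1.
rewrite normrM normrV ?unitfE -?normr_gt0 ?(lt_le_trans _ det_ge1) //.
rewrite ler_pdivrMl ?(lt_le_trans _ det_ge1) //.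
apply: (@le_trans _ _ (r%:R * r`!%:R * H ^+ r.+1)); last first.
  by rewrite ler_peMl // !mulr_ge0 ?exprn_ge0 ?ler0n.
rewrite mxE; apply: le_trans (ler_norm_sum _ _ _) _.
rewrite -mulrA mulr_natl -[X in _ *+ X](card_ord r) -sumr_const.
apply: ler_sum => j _; rewrite normrM exprS mulrCA ler_pM // mxE.
rewrite /cofactor normrM normrX normrN1 expr1n mul1r.
apply: le_trans (det_norm_le _) _ => [a b|]; first by rewrite !mxE; exact: QH.
(* Cofactors have order [r.-1]; their bound is rounded up to order [r]. *)
rewrite ler_pM ?exprn_ge0 ?ler_nat ?leq_fact // ?leq_pred //.
by rewrite ler_weXn2l // leq_pred.
Qed.

(** Caratheodory leaves independent rows, a choice of columns makes them square and invertible, and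
    Cramer bounds the weights. The bound involves the number of columns but not the number of
    rows. *)
Lemma farkas_bound (F : archiRealFieldType) (m k : nat) (M : 'M[F]_(m, k))
    (w : 'rV_k) (H : F) : 1 <= H ->
  (forall i j, M i j \is a Num.int) ->
  (forall i j, `|M i j| <= H) -> (forall j, `|w 0 j| <= H) ->
  (forall y : 'cV_k, (forall i, (M *m y) i 0 <= 0) -> (w *m y) 0 0 <= 0) ->
  exists z : 'rV_m, [/\ forall i, 0 <= z 0 i, z *m M = w
    & forall i, z 0 i <= k%:R ^+ 2 * k`!%:R * H ^+ k.+1].
Proof.
move=> H1 Mint MH wH /farkas[z0 z0_ge0 z0M].
have [r [f [v [free v_ge0 vM]]]] := caratheodory M z0_ge0.
have rk : (r <= k)%N by rewrite -(eqP free) rank_leq_col.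
have fullT : row_full (rowsub f M)^T by rewrite /row_full mxrank_tr.
pose g := fullrankfun fullT.
have Qunit : colsub g (rowsub f M) \in unitmx.
  rewrite -unitmx_tr; have := fullrowsub_unit fullT; congr (_ \in unitmx).
  by apply/matrixP => i j; rewrite !mxE.
have v_le i : v 0 i <= r%:R * r`!%:R * H ^+ r.+1.
  rewrite -[v 0 i]ger0_norm //; apply: (unit_row_norm_le H1 Qunit) => [a b|a b|j].
  - by rewrite !mxE.
  - by rewrite !mxE.
  - rewrite -(_ : colsub g (v *m rowsub f M) = v *m colsub g (rowsub f M)).
      by rewrite vM z0M mxE.
    by apply/rowP => l; rewrite !mxE; apply: eq_bigr => s _; rewrite !mxE.
(* [rowsub f 1%:M] spreads the weights back over all rows. Each entry is a sum of at most [r] of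
   them, whence the second factor [k]. *)
exists (v *m rowsub f 1%:M); split=> [i||i].
- rewrite mxE sumr_ge0 // => j _; rewrite mulr_ge0 // !mxE.
  exact: ler0n.
- rewrite -mulmxA -z0M -vM; congr (_ *m _).
  rewrite -[in RHS](mul1mx M); apply/matrixP => a b; rewrite !mxE.
  by apply: eq_bigr => s _; rewrite !mxE.
- rewrite mxE; apply: (@le_trans _ _ (\sum_(j < r) r%:R * r`!%:R * H ^+ r.+1)).
    apply: ler_sum => j _; rewrite !mxE; case: eqP => _; rewrite ?mulr1 //.
    by rewrite mulr0 (le_trans _ (v_le j)).
  have H0 : 0 <= H by apply: le_trans H1.
  rewrite sumr_const card_ord -[X in X <= _]mulr_natl expr2 !mulrA.
  by rewrite !ler_pM ?mulr_ge0 ?exprn_ge0 ?ler_nat ?leq_fact ?ler_weXn2l.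
Qed.

(** * Trajectories as scalar power series *)

(** Taylor coefficients at 0 of the function [u *m trajectory A x t] of [t]; they reduce its
    differentiation to real power series. *)
Definition flow_coef (R : realType) (d : nat) (u : 'rV[R]_d) (A : 'M[R]_d)
    (x : 'cV[R]_d) (k : nat) : R := (u *m A ^+ k *m x) 0 0 / k`!%:R.

Lemma mul_pow_norm_le (R : realType) (d : nat) (A : 'M[R]_d) (x : 'cV[R]_d) k i :
  `|(A ^+ k *m x) i 0| <= (\sum_l `|x l 0|) * (\sum_l \sum_j `|A l j|) ^+ k.
Proof.
elim: k i => [|k IH] i.
  by rewrite expr0 mul1mx mulr1 (bigD1 i) //= lerDl sumr_ge0.
rewrite exprS -mulmxE -mulmxA mxE (le_trans (ler_norm_sum _ _ _)) //.
rewrite exprS mulrCA.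
apply: (@le_trans _ _ (\sum_j `|A i j| *
   ((\sum_l `|x l 0|) * (\sum_l \sum_j `|A l j|) ^+ k))).
  by apply: ler_sum => j _; rewrite normrM ler_wpM2l.
rewrite -mulr_suml ler_wpM2r ?mulr_ge0 ?exprn_ge0 ?sumr_ge0 //.
  by move=> l _; rewrite sumr_ge0.
by rewrite [leRHS](bigD1 i) //= lerDl sumr_ge0 // => l _; rewrite sumr_ge0.
Qed.

(** Domination by an exponential series, in which the sum [K] of the moduli of the entries of [A]
    replaces an operator norm. *)
Lemma is_cvg_pseries_flow_coef (R : realType) (d : nat) (u : 'rV[R]_d)
    (A : 'M[R]_d) (x : 'cV[R]_d) (t : R) : cvgn (pseries (flow_coef u A x) t).
Proof.
apply: normed_cvg.
pose C := (\sum_l `|u 0 l|) * (\sum_l `|x l 0|).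
pose K := \sum_l \sum_j `|A l j|.
have C0 : 0 <= C by rewrite mulr_ge0 ?sumr_ge0.
have K0 : 0 <= K by rewrite sumr_ge0 // => l _; rewrite sumr_ge0.
apply: (@series_le_cvg _ _ (fun k => C * exp_coeff (K * `|t|) k)).
- by move=> k; exact: normr_ge0.
- by move=> k; rewrite mulr_ge0 // exp_coeff_ge0 // mulr_ge0.
- move=> k; rewrite /flow_coef /exp_coeff /= !normrM normrX normfV exprMn.
  rewrite normr_nat -mulrA [_^-1 * _]mulrC !mulrA.
  rewrite ler_wpM2r ?invr_ge0 // ler_wpM2r ?exprn_ge0 //.
  rewrite -mulmxA mxE (le_trans (ler_norm_sum _ _ _)) // /C -mulrA mulr_suml.
  by apply: ler_sum => j _; rewrite normrM ler_wpM2l // mul_pow_norm_le.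
- by apply: is_cvg_seriesZ; exact: is_cvg_series_exp_coeff.
Qed.

(** The factor [k.+1] cancels in the factorial and the extra power of [A] is absorbed into [u]. *)
Lemma pseries_diffs_flow_coef (R : realType) (d : nat) (u : 'rV[R]_d)
    (A : 'M[R]_d) (x : 'cV[R]_d) :
  pseries_diffs (flow_coef u A x) = flow_coef (u *m A) A x.
Proof.
apply/funext => k; rewrite /pseries_diffs /flow_coef exprS -mulmxE !mulmxA.
rewrite factS natrM invfM mulrCA; congr (_ * _).
by rewrite mulrA mulfV ?mul1r // pnatr_eq0.
Qed.

Lemma is_derive_pseries_flow_coef (R : realType) (d : nat) (u : 'rV[R]_d)
    (A : 'M[R]_d) (x : 'cV[R]_d) (t : R) :
  is_derive t 1 (fun s => limn (pseries (flow_coef u A x) s))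
    (limn (pseries (flow_coef (u *m A) A x) t)).
Proof.
have cvgE v := @is_cvg_pseries_flow_coef R d v A x (`|t| + 1).
rewrite -pseries_diffs_flow_coef.
(* Termwise differentiation asks that the series and its first two formal derivatives converge at a
   point of modulus larger than that of [t]. *)
apply: (@pseries_snd_diffs _ _ (`|t| + 1)).
- exact: cvgE.
- by rewrite pseries_diffs_flow_coef; exact: cvgE.
- by rewrite !pseries_diffs_flow_coef; exact: cvgE.
- by rewrite [X in _ < X]ger0_norm ?addr_ge0 // ltrDl.
Qed.

Lemma cvg_mx_entries (R : realType) (m n : nat) (N : nat -> 'M[R]_(m, n))
    (L : 'M[R]_(m, n)) :
  (forall i j, (fun k => N k i j) @ \oo --> L i j) -> N @ \oo --> L.
Proof.
move=> NL; apply/cvg_mx_entourageP => E entE.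
apply: filter_forall => i; apply: filter_forall => j.
have /cvg_entourageP/(_ E entE) := NL i j.
rewrite !near_map; apply: (@filterS _ \oo _) => k; by rewrite inE.
Qed.

Lemma expmxZ (R : realType) (d : nat) (t : R) (A : 'M[R]_d) k :
  (t *: A) ^+ k = t ^+ k *: A ^+ k.
Proof.
elim: k => [|k IH]; first by rewrite !expr0 scale1r.
by rewrite !exprS IH -!mulmxE -scalemxAl -scalemxAr scalerA.
Qed.

(** [limn] takes a default value on divergent sequences, so convergence must be established; each
    entry is a flow series for two basis vectors. *)
Lemma cvg_mexp (R : realType) (d : nat) (A : 'M[R]_d) (t : R) :
  series (fun k => (k`!%:R : R)^-1 *: (t *: A) ^+ k) @ \oo --> mexp (t *: A).
Proof.
set s := series _.
suff [L sL] : exists L : 'M[R]_d, s @ \oo --> L.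
  by rewrite /mexp -/s (cvg_lim _ sL).
pose f i j := pseries (flow_coef (delta_mx 0 i) A (delta_mx j 0)) t.
exists (\matrix_(i, j) limn (f i j)).
apply: cvg_mx_entries => i j; rewrite mxE.
rewrite [X in X @ _ --> _](_ : _ = f i j).
  exact: is_cvg_pseries_flow_coef.
apply/funext => k; rewrite /s /f /pseries /series /= summxE.
apply: eq_bigr => l _; rewrite expmxZ scalerA mxE /flow_coef.
rewrite -rowE -colE !mxE mulrC mulrA; lra.
Qed.

Lemma continuous_bilin (R : realType) (d : nat) (u : 'rV[R]_d) (x : 'cV[R]_d) :
  continuous (fun N : 'M[R]_d => (u *m N *m x) 0 0).
Proof.
have -> : (fun N : 'M[R]_d => (u *m N *m x) 0 0) =
    \sum_j \sum_i (fun N : 'M[R]_d => u 0 i * N i j * x j 0).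
  apply/funext => N; rewrite fct_sumE mxE; apply: eq_bigr => j _.
  by rewrite fct_sumE mxE mulr_suml.
apply: (big_ind (fun f : 'M[R]_d -> R => continuous f)) => [N|f g cf cg N|j _].
- exact: cst_continuous.
- by apply: continuousD; [exact: cf|exact: cg].
apply: (big_ind (fun f : 'M[R]_d -> R => continuous f)) => [N|f g cf cg N|i _ N].
- exact: cst_continuous.
- by apply: continuousD; [exact: cf|exact: cg].
exact: (cvgM (cvgM (cvg_cst _) (@coord_continuous _ _ _ i j N)) (cvg_cst _)).
Qed.

(** The linear functional sending [N] to [u *m N *m x] is continuous, so it commutes with the limit
    defining [mexp]. *)
Lemma mul_trajectoryE (R : realType) (d : nat) (u : 'rV[R]_d) (A : 'M[R]_d)
    (x : 'cV[R]_d) (t : R) :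
  (u *m trajectory A x t) 0 0 = limn (pseries (flow_coef u A x) t).
Proof.
apply/esym/cvg_lim => //; rewrite /trajectory mulmxA.
have := cvg_comp _ _ (@cvg_mexp R d A t)
  (@continuous_bilin R d u x (mexp (t *: A))).
apply: cvg_trans; apply: near_eq_cvg; near=> k => /=.
rewrite /pseries /series /= mulmx_sumr mulmx_suml summxE.
apply: eq_bigr => l _; rewrite expmxZ scalerA -scalemxAr -scalemxAl mxE.
rewrite /flow_coef.
lra.
Unshelve. all: by end_near. Qed.

Lemma is_derive_mul_trajectory (R : realType) (d : nat) (u : 'rV[R]_d)
    (A : 'M[R]_d) (x : 'cV[R]_d) (t : R) :
  is_derive t 1 (fun s => (u *m trajectory A x s) 0 0)
    ((u *m A *m trajectory A x t) 0 0).
Proof.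
rewrite mul_trajectoryE; under eq_fun do rewrite mul_trajectoryE.
exact: is_derive_pseries_flow_coef.
Qed.

Lemma trajectory_fixpoint (R : realType) (d : nat) (A : 'M[R]_d)
    (x : 'cV[R]_d) (t : R) : A *m x = 0 -> trajectory A x t = x.
Proof.
move=> Ax0; apply/colP => i.
have entryE (y : 'cV[R]_d) : y i 0 = ((delta_mx 0 i : 'rV_d) *m y) 0 0 :> R.
  by rewrite -rowE mxE.
rewrite entryE mul_trajectoryE [RHS]entryE; apply/cvg_lim => //.
(* The empty partial sum is 0; from index 1 on, only the constant term survives. *)
rewrite -(cvg_shiftn 1).
set y := (_ *m x) 0 0.
rewrite [X in X @ _ --> _](_ : _ = cst y); first exact: cvg_cst.
apply/funext => k /=; rewrite addn1 /pseries /series /=.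
rewrite big_nat_recl // big1 ?addr0.
  by rewrite /flow_coef !expr0 mulmx1 divr1 mulr1.
move=> l _; rewrite /flow_coef exprSr -mulmxE -!mulmxA Ax0 !mulmx0.
by rewrite mxE !mul0r.
Qed.

(** * Bit sizes and clearing of denominators *)

(** A product rather than a least common multiple, so that it can be bounded factor by factor
    against the bit size. *)
Definition mx_den (m n : nat) (M : 'M[rat]_(m, n)) : nat :=
  (\prod_(i < m) \prod_(j < n) `|denq (M i j)|)%N.

Lemma leq_nat_bitsize (k : nat) : (k <= 2 ^ nat_bitsize k)%N.
Proof. by apply: ltnW; apply: trunc_log_ltn. Qed.

Lemma leq_rat_bitsize_mx (m n : nat) (M : 'M[rat]_(m, n)) i j :
  (rat_bitsize (M i j) <= mx_bitsize M)%N.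
Proof. by rewrite /mx_bitsize (bigD1 i) //= (bigD1 j) //= -addnA leq_addr. Qed.

Lemma mx_den_gt0 (m n : nat) (M : 'M[rat]_(m, n)) : (0 < mx_den M)%N.
Proof.
by apply: prodn_gt0 => i; apply: prodn_gt0 => j; rewrite absz_gt0 denq_neq0.
Qed.

Lemma mx_den_bitsize (m n : nat) (M : 'M[rat]_(m, n)) :
  (mx_den M <= 2 ^ mx_bitsize M)%N.
Proof.
rewrite /mx_bitsize expn_sum; apply: leq_prod => i _.
rewrite expn_sum; apply: leq_prod => j _.
apply: leq_trans (leq_nat_bitsize _) _.
by rewrite leq_exp2l // leq_addl.
Qed.

Lemma dvdn_mx_den (m n : nat) (M : 'M[rat]_(m, n)) i j :
  (`|denq (M i j)| %| mx_den M)%N.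
Proof.
by rewrite /mx_den (bigD1 i) //= dvdn_mulr // (bigD1 j) //= dvdn_mulr.
Qed.

(** An entry costs a sign bit and at least one digit on each side of the fraction; thus the bit size
    controls the dimensions. *)
Lemma mx_bitsize_ge (m n : nat) (M : 'M[rat]_(m, n)) :
  (3 * (m * n) <= mx_bitsize M)%N.
Proof.
rewrite /mx_bitsize; apply: (@leq_trans (\sum_(i < m) \sum_(j < n) 3)%N).
  by rewrite !sum_nat_const !card_ord; lia.
apply: leq_sum => i _; apply: leq_sum => j _.
by rewrite /rat_bitsize /nat_bitsize; lia.
Qed.

Lemma ratr_norm_le (R : realType) (q : rat) :
  `|ratr q : R| <= 2 ^+ rat_bitsize q.
Proof.
rewrite /ratr normrM normfV -!intr_norm.
have den_ge1 : 1 <= (`|denq q|%:~R : R) by rewrite ler1z; have := denq_gt0 q; lia.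
rewrite ler_pdivrMr ?(lt_le_trans _ den_ge1) //.
apply: (@le_trans _ _ (2 ^+ rat_bitsize q)); last first.
  by rewrite ler_peMr // exprn_ge0.
rewrite -abszE -pmulrn -natrX ler_nat.
apply: leq_trans (leq_nat_bitsize _) _; rewrite leq_exp2l // /rat_bitsize; lia.
Qed.

Lemma ratr_den_int (R : realType) (q : rat) (D : nat) :
  (`|denq q| %| D)%N -> D%:R * (ratr q : R) \is a Num.int.
Proof.
move=> /dvdnP[e ->]; rewrite /ratr natrM.
have -> : `|denq q|%:R = (denq q)%:~R :> R.
  by rewrite pmulrn abszE gtr0_norm.
rewrite -mulrA [X in _ * X]mulrCA mulfV ?intr_eq0 ?denq_neq0 // mulr1.
by rewrite rpredM // ?intr_int // natr_int.
Qed.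

(** The base 4 combines [2 ^ b] for the multiplier with [2 ^ b] for the entry. *)
Lemma scaled_ratmx (R : realType) (m n b : nat) (M : 'M[rat]_(m, n)) (D : nat) :
  (mx_den M %| D)%N -> (D <= 2 ^ b)%N -> (mx_bitsize M <= b)%N ->
  (forall i j, (D%:R *: ratmx R M) i j \is a Num.int) /\
  (forall i j, `|(D%:R *: ratmx R M) i j| <= 4 ^+ b).
Proof.
move=> MD Db Mb; split=> i j; rewrite !mxE.
  by apply: ratr_den_int; apply: dvdn_trans MD; exact: dvdn_mx_den.
have -> : 4 = 2 * 2 :> R by rewrite -natrM.
rewrite normrM normr_nat exprMn ler_pM //.
  by rewrite -natrX ler_nat.
apply: le_trans (ratr_norm_le _ _) _; rewrite ler_weXn2l //.
  by rewrite ler1n.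
exact: leq_trans (leq_rat_bitsize_mx _ _ _) Mb.
Qed.

(** One multiplier serves all three matrices: scaling [B] and [c] together preserves the polytope,
    and scaling [A] preserves its kernel. *)
Lemma cpep_common_denominator (R : realType) (d n : nat) (A : 'M[rat]_d)
    (B : 'M[rat]_(n, d)) (c : 'cV[rat]_n) :
  exists D : nat, let b := cpep_bitsize A B c in
  [/\ (0 < D <= 2 ^ b)%N,
    (forall i j, (D%:R *: ratmx R A) i j \is a Num.int) /\
      (forall i j, `|(D%:R *: ratmx R A) i j| <= 4 ^+ b),
    (forall i j, (D%:R *: ratmx R B) i j \is a Num.int) /\
      (forall i j, `|(D%:R *: ratmx R B) i j| <= 4 ^+ b)
    & (forall i j, (D%:R *: ratmx R c) i j \is a Num.int) /\
      (forall i j, `|(D%:R *: ratmx R c) i j| <= 4 ^+ b)].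
Proof.
pose D := (mx_den A * mx_den B * mx_den c)%N.
have Db : (D <= 2 ^ cpep_bitsize A B c)%N.
  by rewrite /cpep_bitsize !expnD !leq_mul ?mx_den_bitsize.
exists D => b; split; last 3 first.
- apply: scaled_ratmx => //; first by rewrite /D -mulnA dvdn_mulr.
  by rewrite /b /cpep_bitsize; lia.
- apply: scaled_ratmx => //; first by rewrite /D mulnAC dvdn_mull.
  by rewrite /b /cpep_bitsize; lia.
- apply: scaled_ratmx => //; first by rewrite /D dvdn_mull.
  by rewrite /b /cpep_bitsize; lia.
by rewrite Db /D !muln_gt0 !mx_den_gt0.
Qed.

(** * Growth certificate, size of the polytope, escape time *)

Lemma polytopeZ (R : realType) (d n : nat) (B : 'M[R]_(n, d)) (c : 'cV[R]_n)
    (s : R) : 0 < s -> polytope (s *: B) (s *: c) = polytope B c.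
Proof.
move=> s0; apply/eq_set => x; apply/propext.
have E i : ((s *: B *m x) i 0 <= (s *: c) i 0) = ((B *m x) i 0 <= c i 0).
  by rewrite -scalemxAl [(s *: (_ *m _)) i 0]mxE [(s *: c) i 0]mxE ler_pM2l.
by split=> Px i; move: (Px i); rewrite E.
Qed.

Lemma mul_polytope_le (R : realType) (d n : nat) (B : 'M[R]_(n, d))
    (c : 'cV[R]_n) (z : 'rV[R]_n) (x : 'cV[R]_d) :
  (forall i, 0 <= z 0 i) -> polytope B c x ->
  (z *m B *m x) 0 0 <= (z *m c) 0 0.
Proof.
move=> z0 Px; rewrite -mulmxA mxE [X in _ <= X]mxE.
by apply: ler_sum => i _; rewrite ler_wpM2l.
Qed.

(** Farkas for the homogenized system in [(x, s)]: without an equilibrium in the polytope,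
    [B x + c s <= 0] and [A x = 0] force [s >= 0]. The bound is that of a system with [d + 1]
    unknowns. *)
Lemma lyapunov_certificate (R : realType) (d n : nat) (A : 'M[R]_d)
    (B : 'M[R]_(n, d)) (c : 'cV[R]_n) (H : R) : 1 <= H ->
  (forall i j, A i j \is a Num.int) -> (forall i j, `|A i j| <= H) ->
  (forall i j, B i j \is a Num.int) -> (forall i j, `|B i j| <= H) ->
  (forall i j, c i j \is a Num.int) -> (forall i j, `|c i j| <= H) ->
  (forall x, polytope B c x -> A *m x <> 0) ->
  exists mu : 'rV[R]_d,
    (forall j, `|mu 0 j| <= (d + 1)%:R ^+ 2 * (d + 1)`!%:R * H ^+ (d + 1).+1) /\
    (forall x, polytope B c x -> 1 <= (mu *m A *m x) 0 0).
Proof.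
move=> H1 Aint AH Bint BH cint cH noeq.
have H0 : 0 <= H by apply: le_trans H1.
(* The equation [A x = 0] enters as two opposite inequalities, and [w] reads off [- s]. *)
pose M := col_mx (row_mx B c) (col_mx (row_mx A (0 : 'cV_d)) (row_mx (- A) 0)).
pose w := row_mx (0 : 'rV[R]_d) (- 1%:M : 'rV_1).
have entryP (P : R -> Prop) i j : P 0 -> (forall i j, P (A i j)) ->
    (forall i j, P (- A i j)) -> (forall i j, P (B i j)) ->
    (forall i j, P (c i j)) -> P (M i j).
  move=> P0 PA PNA PB Pc; rewrite mxE; case: fintype.split => i1.
    by rewrite mxE; case: fintype.split => j1.
  rewrite mxE; case: fintype.split => i2; rewrite mxE; case: fintype.split => j1;
    by rewrite ?mxE.
have [|||y yM|z [z0 zM zK]] := @farkas_bound _ _ _ M w H H1.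
- move=> i j; apply: (entryP (fun a => a \is a Num.int)) => // i1 j1.
  by rewrite rpredN.
- move=> i j; apply: (entryP (fun a => `|a| <= H)) => //; first by rewrite normr0.
  by move=> i1 j1; rewrite normrN.
- move=> j; rewrite mxE; case: fintype.split => j1; rewrite !mxE ?normr0 //.
  by rewrite ord1 normrN normr1.
- pose y1 := usubmx y; pose y2 := dsubmx y.
  have defy : y = col_mx y1 y2 by rewrite vsubmxK.
  move: yM; rewrite defy /M /w !mul_col_mx !mul_row_col !mul0mx !addr0 add0r.
  rewrite !mulNmx mul1mx [(- y2) 0 0]mxE oppr_le0 => yM.
  rewrite leNgt; apply/negP => y2_lt0.
  have By i : (B *m y1 + c *m y2) i 0 <= 0.
    by have := yM (lshift _ i); rewrite col_mxEu.
  have Ay i : (A *m y1) i 0 <= 0.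
    by have := yM (rshift _ (lshift _ i)); rewrite col_mxEd col_mxEu.
  have NAy i : (- (A *m y1)) i 0 <= 0.
    by have := yM (rshift _ (rshift _ i)); rewrite !col_mxEd.
  (* Dehomogenizing y would give an equilibrium in the polytope. *)
  apply: (noeq ((- y2 0 0)^-1 *: y1)).
    move=> i; rewrite -scalemxAr mxE ler_pdivrMl ?oppr_gt0 //.
    have := By i; rewrite mxE [(c *m y2) i 0]mxE big_ord1; lra.
  rewrite -scalemxAr; apply/eqP; rewrite scaler_eq0; apply/orP; right.
  apply/eqP/colP => i; have := Ay i; have := NAy i.
  by rewrite [(- (A *m y1)) _ _]mxE [(0 : 'cV_d) _ _]mxE; lra.
pose zB := lsubmx z; pose zP := lsubmx (rsubmx z); pose zN := rsubmx (rsubmx z).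
have defz : z = row_mx zB (row_mx zP zN) by rewrite !hsubmxK.
move: zM; rewrite [X in X *m _]defz /M /w !mul_row_col !mul_mx_row !add_row_mx.
rewrite !mulmx0 !addr0 => /eq_row_mx[zAB zc].
have z_part p (f : 'I_p -> 'I_(n + (d + d))) j : 0 <= z 0 (f j) <=
    (d + 1)%:R ^+ 2 * (d + 1)`!%:R * H ^+ (d + 1).+1 by rewrite z0 zK.
(* A difference of two numbers between 0 and the bound, so no factor 2 is lost. *)
exists (zP - zN); split=> [j|x Px].
  have := z_part _ (fun j => rshift n (lshift d j)) j.
  have := z_part _ (fun j => rshift n (rshift d j)) j.
  rewrite !mxE => /andP[? ?] /andP[? ?]; rewrite ler_norml.
  by apply/andP; split; lra.
have zB0 i : 0 <= zB 0 i by rewrite mxE.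
have := mul_polytope_le zB0 Px.
have -> : zB *m B = - ((zP - zN) *m A).
  apply/eqP; rewrite -subr_eq0 opprK mulmxBl -mulmxN; exact/eqP.
by rewrite zc mulNmx [(- (_ *m x)) 0 0]mxE [(- 1%:M) 0 0]mxE lerN2 mxE.
Qed.

(* A bounded nonempty P has trivial recession cone, so by Farkas each vector
   +-e_j is a nonnegative combination of the rows of B. *)
Lemma coord_le_polytope (R : realType) (d n : nat) (B : 'M[R]_(n, d))
    (c : 'cV[R]_n) (H C : R) : 1 <= H ->
  (forall i j, B i j \is a Num.int) -> (forall i j, `|B i j| <= H) ->
  (forall i, `|c i 0| <= H) ->
  (forall x j, polytope B c x -> `|x j 0| <= C) ->
  forall x j, polytope B c x ->
    `|x j 0| <= n%:R * (d%:R ^+ 2 * d`!%:R * H ^+ d.+1) * H.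
Proof.
move=> H1 Bint BH cH bounded x j Px.
have H0 : 0 <= H by apply: le_trans H1.
have side (s : R) : `|s| = 1 ->
    s * x j 0 <= n%:R * (d%:R ^+ 2 * d`!%:R * H ^+ d.+1) * H.
  move=> s1; pose w : 'rV[R]_d := s *: delta_mx 0 j.
  have wE (y : 'cV[R]_d) : (w *m y) 0 0 = s * y j 0.
    by rewrite -scalemxAl -rowE !mxE.
  have [||z [z0 zB zK]] := @farkas_bound _ _ _ B w H H1 Bint BH.
  - move=> k; rewrite !mxE normrM s1 mul1r eqxx /=.
    by case: eqP; rewrite ?normr1 ?normr0.
  - move=> y By; rewrite wE leNgt; apply/negP => sy.
    have C0 : 0 <= C by apply: le_trans (bounded x j Px).
    (* Moving by [r *: y] shifts coordinate [j] by [2 C + 1], while two points of the polytope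
       differ there by at most [2 C]. *)
    pose r := (C + C + 1) / (s * y j 0).
    have r0 : 0 <= r by rewrite divr_ge0 ?addr_ge0 // ltW.
    have Pxy : polytope B c (x + r *: y).
      move=> i; rewrite mulmxDr -scalemxAr mxE [X in _ + X]mxE.
      have := Px i; have := mulr_ge0_le0 r0 (By i); lra.
    have := bounded _ j Pxy; have := bounded _ j Px.
    have -> : (x + r *: y) j 0 = x j 0 + r * y j 0 by rewrite !mxE.
    have ry : `|r * y j 0| = C + C + 1.
      have -> : `|r * y j 0| = `|r * (s * y j 0)|.
        by rewrite mulrCA [RHS]normrM s1 mul1r.
      rewrite divfK ?gt_eqF // ger0_norm //.
      by rewrite !addr_ge0.
    have := ler_normB (x j 0 + r * y j 0) (x j 0).
    rewrite addrAC subrr add0r ry; lra.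
  - rewrite -wE -zB; apply: le_trans (mul_polytope_le z0 Px) _.
    rewrite mxE -mulrA mulr_natl -[X in _ *+ X](card_ord n) -sumr_const.
    apply: ler_sum => i _; apply: le_trans (ler_norm _) _.
    by rewrite normrM ler_pM // ger0_norm.
have := side 1 (normr1 _); have := side (-1) (normrN1 _).
rewrite ler_norml => h1 h2; apply/andP; split; lra.
Qed.

(** By the mean value theorem [mu x] grows by at least [e * T] over the interval, while its end
    values differ by at most [2 G]. *)
Lemma escape_time_le (R : realType) (d : nat) (A : 'M[R]_d) (P : set 'cV[R]_d)
    (mu : 'rV[R]_d) (e G T : R) (x0 : 'cV[R]_d) : 0 <= T ->
  (forall x, P x -> e <= (mu *m A *m x) 0 0) ->
  (forall x, P x -> `|(mu *m x) 0 0| <= G) ->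
  (forall t, 0 <= t <= T -> P (trajectory A x0 t)) ->
  e * T <= G + G.
Proof.
move=> T0 Pe PG stay.
have deriv s := is_derive_mul_trajectory mu A x0 s.
have cont : {within `[0, T],
    continuous (fun s => (mu *m trajectory A x0 s) 0 0)}.
  apply: derivable_within_continuous => s _.
  exact: (@ex_derive _ _ _ _ _ _ _ (deriv s)).
have [s sT] := MVT_segment T0 (fun s _ => deriv s) cont.
rewrite subr0 => eqT.
have PT : P (trajectory A x0 T) by apply: stay; rewrite T0 lexx.
have P0 : P (trajectory A x0 0) by apply: stay; rewrite T0 lexx.
have Ps : P (trajectory A x0 s) by apply: stay; move: sT; rewrite in_itv.
apply: (@le_trans _ _ ((mu *m A *m trajectory A x0 s) 0 0 * T)).
  by rewrite ler_wpM2r // Pe.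
rewrite -eqT; apply: le_trans (ler_norm _) _; apply: le_trans (ler_normB _ _) _.
by rewrite lerD // PG.
Qed.

(** * Numerical estimates *)

Lemma leq_fact_exp2 (k : nat) : (k`! <= 2 ^ (k * k))%N.
Proof.
elim: k => // k IH; rewrite factS.
apply: (@leq_trans (2 ^ k.+1 * 2 ^ (k * k))).
  by rewrite leq_mul // ltnW // ltn_expl.
by rewrite -expnD leq_exp2l //; lia.
Qed.

(** The left side multiplies the bounds on the certificate, on the coordinates of the polytope and
    on the common denominator. Replacing each factor by a power of two leaves only exponents to
    compare. *)
Lemma escape_bound_leq_exp2 (d n b D : nat) :
  (0 < d)%N -> (d <= b)%N -> (n <= b)%N -> (D <= 2 ^ b)%N ->
  (2 * (d * ((d + 1) ^ 2 * (d + 1)`! * (4 ^ b) ^ (d + 1).+1)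
     * (n * (d ^ 2 * d`! * (4 ^ b) ^ d.+1) * 4 ^ b)) * D
   <= 2 ^ (640 * b * d ^ 2))%N.
Proof.
move=> d0 db nb Db.
have le2 k : (k <= 2 ^ k)%N by rewrite ltnW // ltn_expl.
have sq k : (k ^ 2 <= 2 ^ (k * 2))%N by rewrite expnM leq_exp2r.
have pow4 k : ((4 ^ b) ^ k = 2 ^ (2 * b * k))%N.
  by rewrite (expnM 2 (2 * b) k) (expnM 2 2 b).
have nb2 : (n <= 2 ^ b)%N := leq_trans nb (le2 b).
rewrite !pow4 (_ : 4 ^ b = 2 ^ (2 * b * 1))%N; last by rewrite -pow4 expn1.
have := leq_mul (leq_mul (leqnn (2 ^ 1)) (leq_mul
  (leq_mul (le2 d) (leq_mul (leq_mul (sq (d + 1)) (leq_fact_exp2 (d + 1)))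
     (leqnn (2 ^ (2 * b * (d + 1).+1)))))
  (leq_mul (leq_mul nb2 (leq_mul (leq_mul (sq d) (leq_fact_exp2 d))
     (leqnn (2 ^ (2 * b * d.+1))))) (leqnn (2 ^ (2 * b * 1)))))) Db.
rewrite expn1 => /leq_trans; apply; rewrite -[X in (X * _ * _)%N]expn1 -!expnD.
rewrite leq_exp2l //.
(* With these facts every monomial of the exponent is dominated by [b * d * d], and the comparison
   becomes linear. *)
have bd : (b <= b * d)%N by rewrite leq_pmulr.
have bdd : (b * d <= b * d * d)%N by rewrite leq_pmulr.
have dd : (d * d <= b * d * d)%N by rewrite leq_mul // leq_pmull // (leq_trans d0).
rewrite -[(d ^ 2)%N]mulnn; lia.
Qed.

Lemma exp2_le_expR (R : realType) (k : nat) : (2 ^ k)%:R <= expR k%:R :> R.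
Proof.
rewrite natrX -[k%:R]mulr1 expRM_natl lerXn2r ?nnegrE ?expR_ge0 //.
by have := expR_ge1Dx (1 : R).
Qed.

(** Since [3 <= b], the factor 4 is absorbed by [expR b]; the exponents then compare with room to
    spare. *)
Lemma escape_time_le_doubly_exp (R : realType) (b d : nat) : (3 <= b)%N ->
  4 * expR (640 * b%:R * d%:R ^+ (4 * d + 10)) <=
  expR (1000 * b%:R * d%:R `^ (1000 * d%:R)) :> R.
Proof.
move=> b3; have b3R : 3 <= b%:R :> R by rewrite ler_nat.
have e4 : 4 <= expR b%:R :> R.
  by apply: le_trans (expR_ge1Dx _); lra.
apply: le_trans (_ : expR b%:R * expR (640 * b%:R * d%:R ^+ (4 * d + 10)) <= _).
  by apply: ler_wpM2r; [exact: expR_ge0 | exact: e4].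
rewrite -expRD ler_expR -(natrM _ 1000 d) powR_mulrn //.
(* In dimension 0 the power on the left is 0 and the one on the right is [0 ^ 0 = 1]. *)
case: d => [|d].
  by rewrite !muln0 add0n !expr0n /= mulr0 addr0 mulr1 ler_peMl //; lra.
have le1 : 1 <= d.+1%:R ^+ (1000 * d.+1) :> R by rewrite exprn_ege1 // ler1n.
have leP : d.+1%:R ^+ (4 * d.+1 + 10) <= d.+1%:R ^+ (1000 * d.+1) :> R.
  by rewrite ler_weXn2l ?ler1n //; lia.
set p := d.+1%:R ^+ (4 * _ + _) in leP *; set q := d.+1%:R ^+ _ in le1 leP *.
nra.
Qed.

(** * Escape before the announced time *)

Lemma normr_coord_le (R : realType) (d : nat) (x : 'cV[R]_d) j :
  `|x j 0| <= `|x|.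
Proof. by rewrite [leRHS]/Num.Def.normr /= mx_normrE (le_bigmax _ _ (j, 0)). Qed.

Theorem theorem3 (R : realType) :
  exists kappa : R, 0 < kappa /\
  forall (d n b : nat) (A : 'M[rat]_d) (B : 'M[rat]_(n, d)) (c : 'cV[rat]_n),
    cpep_positive (ratmx R A) (ratmx R B) (ratmx R c) ->
    compact (polytope (ratmx R B) (ratmx R c)) ->
    cpep_bitsize A B c = b ->
    let T : R := 4 * expR (640 * b%:R * d%:R ^+ (4 * d + 10)) in
    T <= expR (kappa * b%:R * d%:R `^ (kappa * d%:R)) /\
    forall x0 : 'cV[R]_d, polytope (ratmx R B) (ratmx R c) x0 ->
      exists t0 : R, 0 <= t0 <= T /\
        ~ polytope (ratmx R B) (ratmx R c) (trajectory (ratmx R A) x0 t0).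
Proof.
exists 1000; split=> [|d n b A B c pos cpt hb T]; first by rewrite ltr0n.
have bE : (3 * (d * d) + 3 * (n * d) + 3 * (n * 1) <= b)%N.
  by rewrite -hb !leq_add ?mx_bitsize_ge.
have noeq x : polytope (ratmx R B) (ratmx R c) x -> ratmx R A *m x <> 0.
  by move=> Px Ax0; have [t [_]] := pos x Px; rewrite trajectory_fixpoint.
(* With no constraint the polytope is the whole space and nothing escapes; otherwise one entry of
   [c] already takes 3 bits. *)
have b3 : (3 <= b)%N.
  have [n0|] := posnP n; last by lia.
  by subst n; have [|t [_ []]] := pos 0; case.
split=> [|x0 Px0]; first exact: escape_time_le_doubly_exp.
(* In dimension 0 the only point is an equilibrium. *)
have d0 : (0 < d)%N.
  have [d0|//] := posnP d; subst d.
  by case: (noeq x0 Px0); exact: flatmx0.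
apply: contrapT => /forallNP stuck.
have stay t : 0 <= t <= T ->
    polytope (ratmx R B) (ratmx R c) (trajectory (ratmx R A) x0 t).
  by move=> tT; apply: contrapT => esc; apply: (stuck t).
have [D []] := cpep_common_denominator R A B c.
rewrite hb => /andP[D0 Db] [Aint AH] [Bint BH] [cint cH].
have DR : 0 < D%:R :> R by rewrite ltr0n.
have PD := polytopeZ (ratmx R B) (ratmx R c) DR.
have H1 : 1 <= 4 ^+ b :> R by rewrite exprn_ege1 // ler1n.
have [|mu [mu_le mu_ge1]] :=
    @lyapunov_certificate _ _ _ _ _ _ _ H1 Aint AH Bint BH cint cH.
  rewrite PD => x /noeq Ax; rewrite -scalemxAl => /eqP.
  by rewrite scaler_eq0 gt_eqF //= => /eqP.
rewrite PD in mu_ge1.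
(* Compactness gives a bound [C] of unknown size, which is then traded for the explicit bound
   [K2]. *)
have [C _ PC] := pinfty_ex_gt0 (compact_bounded cpt).
have x_le := @coord_le_polytope _ _ _ _ _ _ C H1 Bint BH (fun i => cH i 0).
rewrite PD in x_le.
have {}x_le := x_le (fun x j Px => le_trans (normr_coord_le x j) (PC x Px)).
set K1 := (_ * _ * _) in mu_le; set K2 := (_ * _) in x_le.
have T0 : 0 <= T by rewrite mulr_ge0 ?expR_ge0.
have mux x : polytope (ratmx R B) (ratmx R c) x ->
    `|(mu *m x) 0 0| <= d%:R * (K1 * K2).
  move=> Px; rewrite mxE (le_trans (ler_norm_sum _ _ _)) //.
  rewrite mulr_natl -[X in _ *+ X](card_ord d) -sumr_const.
  by apply: ler_sum => j _; rewrite normrM ler_pM // x_le.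
(* Unit growth for the scaled matrix [D A] means growth at rate at least [1 / D] for [A]. *)
have deriv x : polytope (ratmx R B) (ratmx R c) x ->
    D%:R^-1 <= (mu *m ratmx R A *m x) 0 0.
  move=> /mu_ge1; rewrite -scalemxAr -scalemxAl mxE => ?.
  by rewrite -[leLHS]mulr1 ler_pdivrMl.
have := escape_time_le T0 deriv mux stay.
rewrite ler_pdivrMl // leNgt => /negP; apply.
(* The factor 4 in [T] makes the inequality strict. *)
apply: (@le_lt_trans _ _ (expR (640 * b%:R * d%:R ^+ (4 * d + 10)))); last first.
  by rewrite /T ltr_pMl ?expR_gt0 // ltr1n.
(* The estimate has exponent [640 b d^2], relaxed here to the announced power of [d]. *)
apply: le_trans (_ : expR (640 * b * d ^ 2)%:R <= _); last first.
  rewrite ler_expR natrM natrX (natrM _ 640 b).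
  apply: ler_wpM2l; first by rewrite -natrM ler0n.
  by rewrite ler_weXn2l ?ler1n //; lia.
apply: le_trans (exp2_le_expR _ _).
have db : (d <= b)%N by nia.
have nb : (n <= b)%N by lia.
apply: le_trans (_ : (_)%:R <= _); last first.
  by rewrite ler_nat; exact: (escape_bound_leq_exp2 d0 db nb Db).
by rewrite !(natrM, natrX) /K1 /K2; lra.
Qed.
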